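(* For every fixed $r\ge 2$, $\mathrm{sat}_\circlearrowright(n,M_1^{(r)})=(1+o(1))\binom{n}{r-1}$ as $n\to\infty$. Moreover: (i) for every $n\ge 4$, every $M_1^{(2)}$-saturated $2$-cgh on $\Omega_n$ has exactly $n$ edges; (ii) for every $n\ge 6$, $\mathrm{sat}_\circlearrowright(n,M_1^{(3)})=\binom{n-1}{2}+3n-11$, and for every $n>6$ the $3$-cgh $H_n^{(3)}$ is, up to isomorphism, the unique $M_1^{(3)}$-saturated $3$-cgh on $\Omega_n$ with this number of edges.
   Context: A convex geometric hypergraph (cgh) on $\Omega_n=\{v_0,\dots,v_{n-1}\}$ is a family of subsets (edges) of $\Omega_n$, where the vertices carry the cyclic order $v_0<v_1<\dots<v_{n-1}<v_0$ (think of points placed clockwise on a circle; indices are taken mod $n$). It is an $r$-cgh if all edges have size $r$. Two cghs are isomorphic if there is a bijection between their vertex sets preserving the cyclic order and inducing a bijection between edge sets. For an $r$-cgh $F$, $H$ contains a copy of $F$ if there is an injection of the vertex set of $F$ into $\Omega_n$ preserving cyclic order and mapping every edge of $F$ to an edge of $H$; $H$ is $F$-free if it contains no copy of $F$. $H\subseteq\binom{\Omega_n}{r}$ is $F$-saturated if it is $F$-free and for every $e\in\binom{\Omega_n}{r}\setminus H$, $H\cup\{e\}$ contains a copy of $F$. $\mathrm{sat}_\circlearrowright(n,F)$ is the minimum number of edges of an $F$-saturated $r$-cgh on $\Omega_n$. $M_1^{(r)}$ is the $r$-cgh on $\Omega_{2r}$ with the two edges $\{v_0,\dots,v_{r-1}\}$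 and $\{v_r,\dots,v_{2r-1}\}$ (two geometrically disjoint edges). For vertices $v_i\neq v_j$, $(v_i,v_j)$ denotes the set of vertices strictly between $v_i$ and $v_j$ when moving clockwise (increasing index mod $n$) from $v_i$ to $v_j$, and $[v_i,v_j]=(v_i,v_j)\cup\{v_i,v_j\}$. Define $$H_n^{(r)}=\Big\{h\in\tbinom{\Omega_n}{r}: v_0\in h\Big\}\cup\bigcup_{j=1}^{r-1}\Big\{h\in\tbinom{\Omega_n}{r}: v_j\in h,\ h\cap[v_{n-r+j},v_{n-1}]\neq\emptyset\Big\}.$$ For example $H_n^{(3)}$ consists of all triples containing $v_0$ together with all triples containing one of the pairs $\{v_1,v_{n-2}\},\{v_1,v_{n-1}\},\{v_2,v_{n-1}\}$. *)

(* Defs.v *)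
From mathcomp Require Import all_boot all_order all_algebra.
Set Implicit Arguments. Unset Strict Implicit. Unset Printing Implicit Defensive.

(* Vertices of Omega_n are the ordinals 'I_n (v_i is the ordinal i). *)

(* (a, b, c) occur in this (clockwise = increasing-index) cyclic order. *)
Definition cyc (a b c : nat) : bool :=
  [|| (a < b < c)%N, (b < c < a)%N | (c < a < b)%N].

Definition cyc_pres (m n : nat) (f : 'I_m -> 'I_n) : bool :=
  [forall a : 'I_m, forall b : 'I_m, forall c : 'I_m,
     cyc a b c ==> cyc (f a) (f b) (f c)].

Definition is_rcgh (n r : nat) (H : {set {set 'I_n}}) : bool :=
  [forall e in H, #|e| == r].

Definition contains (n m : nat) (H : {set {set 'I_n}}) (F : {set {set 'I_m}}) : bool :=
  [exists f : {ffun 'I_m -> 'I_n},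
    [&& injectiveb f, cyc_pres f & [forall e in F, f @: e \in H]]].

Definition free (n m : nat) (H : {set {set 'I_n}}) (F : {set {set 'I_m}}) : bool :=
  ~~ contains H F.

Definition saturated (n r m : nat) (F : {set {set 'I_m}}) (H : {set {set 'I_n}}) : bool :=
  [&& is_rcgh r H, free H F &
      [forall e : {set 'I_n}, ((#|e| == r) && (e \notin H)) ==> contains (e |: H) F]].

(* sat_o(n, F): minimum number of edges of an F-saturated r-cgh on Omega_n.
   The default value #|r-subsets| is an upper bound for every r-cgh, so the
   minimum below is the true minimum whenever a saturated r-cgh exists. *)
Definition sat (n r m : nat) (F : {set {set 'I_m}}) : nat :=
  \big[minn/#|[set e : {set 'I_n} | #|e| == r]|]_(H : {set {set 'I_n}} |
      saturated r F H) #|H|.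

Definition M1 (r : nat) : {set {set 'I_(2 * r)}} :=
  [set [set i : 'I_(2 * r) | (i < r)%N]; [set i : 'I_(2 * r) | (r <= i)%N]].

Definition cgh_iso (n : nat) (H1 H2 : {set {set 'I_n}}) : Prop :=
  exists f : 'I_n -> 'I_n,
    [/\ bijective f, cyc_pres f & forall e, (e \in H1) = (f @: e \in H2)].

Definition Hn (n r : nat) : {set {set 'I_n}} :=
  [set h : {set 'I_n} | (#|h| == r) &&
     ([exists x in h, nat_of_ord x == 0%N] ||
      [exists j : 'I_r, [&& (0 < j)%N,
          [exists x in h, nat_of_ord x == nat_of_ord j] &
          [exists y in h, (n - r + j <= y <= n - 1)%N]]])].

(* Main.v *)
Require Import Defs.
From mathcomp Require Import all_boot all_order all_algebra zify.
Import Order.TTheory GRing.Theory Num.Theory.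
Set Implicit Arguments. Unset Strict Implicit. Unset Printing Implicit Defensive.

(** Call an arc occupied when it contains an edge of a saturated family H on N
    points, N >= 2r. Two edges form a copy of M_1 iff some arc contains one and
    misses the other, so of an arc and its complement exactly one is occupied:
    they cannot both be, and if neither were, an r-set through both ends of the
    longer one could be added to H. An r-set is a non-edge iff one of its gaps is
    occupied, and that gap is then unique; hence, N_l being the number of occupied
    arcs of length l,
      |H| = C(N, r) - sum_(r <= l <= N - r) N_l C(N - 2 - l, r - 2),
    where N_l + N_(N-l) = N, and N_l <= l for 2l <= N by Katona's cycle argument.
    For r = 2 the sum is determined by the duality alone. In general it is largest
    when N_l = l, which happens for H_n^(r), whose occupied arcs of intermediate
    length are those through v_0. For r = 3 and N > 6, equality forces three
    pairwise meeting occupied arcs of length 3, so they share a vertex, and this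
    determines H up to rotation. *)

(** * Clockwise distances and arcs *)

Definition dist {n} (a b : 'I_n.+1) : nat := if a <= b then b - a else n.+1 + b - a.
Definition cshift {n} (a : 'I_n.+1) (k : nat) : 'I_n.+1 := inZp (a + k).
Definition carc {n} (s : 'I_n.+1) (l : nat) : {set 'I_n.+1} := [set x | dist s x < l].

Lemma distP n (a b : 'I_n.+1) :
  (a < n.+1 /\ b < n.+1) /\
  ((a <= b /\ dist a b = b - a) \/ (b < a /\ dist a b = n.+1 + b - a)).
Proof. by split; [rewrite !ltn_ord | rewrite /dist; case: leqP; [left | right]]. Qed.

Lemma cshiftP n (a : 'I_n.+1) k : k <= n.+1 ->
  a < n.+1 /\
  ((a + k < n.+1 /\ nat_of_ord (cshift a k) = a + k) \/
   (n.+1 <= a + k /\ nat_of_ord (cshift a k) = a + k - n.+1)).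
Proof.
move=> kn; split; first exact: ltn_ord.
rewrite /=; have an := ltn_ord a; case: (ltnP (a + k) n.+1) => ak; [left|right].
  by rewrite modn_small.
split=> //; rewrite -[in LHS](subnK ak) modnDr modn_small //; lia.
Qed.

Ltac revert_props := repeat match goal with
  | H : ?T |- _ => match type of T with Prop => revert H end end.
(** Reverting the hypotheses first lets [generalize] abstract the distances inside them too. Each
    distance is then known only through the two linear cases of [distP], which leaves a problem for
    [lia]. *)
Ltac circ :=
  revert_props;
  repeat match goal with
  | |- context [@dist ?n ?a ?b] => generalize (@distP n a b); generalize (@dist n a b)
  end;
  intros; lia.

Lemma dist_cshift n (a : 'I_n.+1) k : k <= n -> dist a (cshift a k) = k.
Proof. move=> kn; have := @cshiftP n a k (leqW kn); circ. Qed.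

Lemma cshift_dist n (a b : 'I_n.+1) : cshift a (dist a b) = b.
Proof.
apply: ord_inj; have Hd : dist a b <= n.+1 by circ.
have := @cshiftP n a _ Hd; circ.
Qed.

Lemma dist_inj n (a : 'I_n.+1) : injective (dist a).
Proof. by move=> x y xy; apply: ord_inj; circ. Qed.

Lemma dist_injl n (a : 'I_n.+1) : injective (dist^~ a).
Proof. by move=> x y /= xy; apply: ord_inj; circ. Qed.

Lemma in_carc n (s x : 'I_n.+1) l : (x \in carc s l) = (dist s x < l).
Proof. by rewrite inE. Qed.

Lemma carcC n (s : 'I_n.+1) l : l <= n.+1 -> ~: carc s l = carc (cshift s l) (n.+1 - l).
Proof.
move=> ln; apply/setP => x; rewrite inE !in_carc.
have := @cshiftP n s l ln; circ.
Qed.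

(** An injection of n+1 points into values below n+1 is a bijection, so every initial segment of
    values is attained. With distances from a point this counts an arc; with distances to a point it
    counts the arcs through it. *)
Lemma card_lt_preim n (g : 'I_n.+1 -> nat) l : injective g -> (forall x, g x < n.+1) ->
  l <= n.+1 -> #|[set x | g x < l]| = l.
Proof.
move=> ginj gn ln; pose h x := Ordinal (gn x).
have hinj : injective h by move=> x y /(congr1 val) /ginj.
have -> : [set x | g x < l] = h @^-1: [set widen_ord ln i | i in [set: 'I_l]].
  apply/setP => x; rewrite !inE; apply/idP/imsetP => [gl|[i _ /(congr1 val) /= ->]].
    by exists (Ordinal gl) => //; apply: ord_inj.
  exact: ltn_ord.
rewrite card_preimset // card_imset; first by rewrite cardsT card_ord.
by move=> i j /(congr1 val) /= ij; apply: ord_inj.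
Qed.

Lemma card_carc n (s : 'I_n.+1) l : l <= n.+1 -> #|carc s l| = l.
Proof. by apply: card_lt_preim => [|x]; [exact: dist_inj | circ]. Qed.

Lemma card_carc_starts n (v : 'I_n.+1) l : l <= n.+1 -> #|[set s | v \in carc s l]| = l.
Proof.
move=> ln; rewrite -[RHS](@card_lt_preim n (dist^~ v) l) //; first last.
  by move=> x; circ.
  exact: dist_injl.
by apply: eq_card => s; rewrite !inE.
Qed.

Lemma dist_lt n (a b : 'I_n.+1) : dist a b < n.+1.
Proof. circ. Qed.

Lemma distxx n (a : 'I_n.+1) : dist a a = 0.
Proof. circ. Qed.

Lemma dist_relP n (s a b : 'I_n.+1) :
  (dist s a < n.+1 /\ dist s b < n.+1) /\
  ((dist s a <= dist s b /\ dist a b = dist s b - dist s a) \/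
   (dist s b < dist s a /\ dist a b = n.+1 + dist s b - dist s a)).
Proof. circ. Qed.

(* Measuring all distances from one base point leaves far fewer cases to lia. *)
Ltac circ_from s :=
  revert_props;
  repeat match goal with
  | |- context [@dist ?n ?a ?b] =>
      tryif constr_eq a s then fail
      else (generalize (@dist_relP n s a b); generalize (@dist n a b))
  end;
  rewrite ?distxx;
  repeat match goal with
  | |- context [@dist ?n s ?b] => generalize (@dist_lt n s b); generalize (@dist n s b)
  end;
  intros; lia.

(** An arc avoiding both end points of another cannot cross its boundary; where it starts decides on
    which side it lies. *)
Lemma carc_dichotomy n (s t : 'I_n.+1) l k : 0 < l <= n.+1 ->
  s \notin carc t k -> cshift s l.-1 \notin carc t k ->
  carc t k \subset carc s l \/ carc t k \subset ~: carc s l.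
Proof.
move=> /andP[l0 ln]; rewrite !in_carc => sk slk.
have := @dist_cshift n s l.-1; move: (cshift s l.-1) slk => w slk.
rewrite -ltnS prednK // => /(_ ln) Hw.
case: (ltnP (dist s t) l) => st; [left|right]; apply/subsetP => u; rewrite ?inE; circ_from s.
Qed.

(** * Copies of M_1 as separated pairs of edges *)

Definition separated {n} (e f : {set 'I_n.+1}) : Prop :=
  exists s l, [/\ l <= n.+1, e \subset carc s l & [disjoint f & carc s l]].

Lemma separated_sym n (e f : {set 'I_n.+1}) : separated e f -> separated f e.
Proof.
move=> [s [l [ln es fs]]]; exists (cshift s l), (n.+1 - l); split; first exact: leq_subr.
  by rewrite -carcC // -disjoints_subset.
by rewrite -carcC // -setI_eq0 -setDE setD_eq0.
Qed.

Lemma separated_irr n (e : {set 'I_n.+1}) : 0 < #|e| -> ~ separated e e.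
Proof.
move=> /card_gt0P[x xe] [s [l [_ es]]] /disjointFr /(_ xe).
by rewrite (subsetP es).
Qed.

(** Cutting the circle at [s] turns the cyclic order into the linear order of distances from [s], a
    rotation under which [cyc] is invariant. *)
Lemma dist_mono_cyc_pres m n (g : 'I_m -> 'I_n.+1) s :
  {homo (fun i => dist s (g i)) : i j / val i < val j >-> i < j} -> cyc_pres g.
Proof.
move=> gm; apply/forallP => a; apply/forallP => b; apply/forallP => c.
apply/implyP; rewrite /cyc.
have := (gm a b, gm b c, gm c a, gm b a, gm c b, gm a c) => /= -[[[[[]]]]].
move=> gab gbc gca gba gcb gac H.
have {gab gbc gca gba gcb gac}H : cyc (dist s (g a)) (dist s (g b)) (dist s (g c)).
  move: H; rewrite /cyc.
  case/or3P => /andP[h1 h2]; apply/or3P.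
  - by constructor 1; rewrite gab // gbc.
  - by constructor 2; rewrite gbc // gca.
  - by constructor 3; rewrite gca // gab.
by move: H; rewrite /cyc; circ.
Qed.

Lemma cyc_dist n (a b c : 'I_n.+1) : cyc a b c -> 0 < dist a b < dist a c.
Proof. rewrite /cyc; circ. Qed.

Lemma containsP n r (H : {set {set 'I_n.+1}}) : 0 < r -> (forall e, e \in H -> #|e| = r) ->
  reflect (exists e f, [/\ e \in H, f \in H & separated e f]) (contains H (M1 r)).
Proof.
move=> r0 Hr; apply: (iffP existsP) => [[g /and3P[/injectiveP ginj gc gH]]|].
  set L := [set i : 'I_(2 * r) | i < r]; set R := [set i : 'I_(2 * r) | r <= i].
  exists (g @: L), (g @: R).
  have gc' (a b c : 'I_(2 * r)) : cyc a b c -> cyc (g a) (g b) (g c).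
    by move: gc => /forallP/(_ a)/forallP/(_ b)/forallP/(_ c)/implyP.
  split; try by apply: (forall_inP gH); rewrite !inE eqxx ?orbT.
  have z0 : 0 < 2 * r by lia.
  have rr : r < 2 * r by lia.
  pose z := Ordinal z0; pose w := Ordinal rr.
  (* The arc runs from the image of v_0 to just before the image of v_r; [cyc_dist] puts the other
     images on the correct side. *)
  exists (g z), (dist (g z) (g w)); split; first exact: ltnW (dist_lt _ _).
    apply/subsetP => _ /imsetP[i iL ->]; rewrite in_carc; move: iL; rewrite inE => ir.
    case: (posnP i) => i0.
      have -> : i = z by apply: ord_inj.
      rewrite distxx lt0n; apply/eqP => d0.
      have : g z = g w by apply: (@dist_inj _ (g z)); rewrite distxx.
      by move/ginj/(congr1 val) => /=; lia.
    have : cyc z i w by rewrite /cyc /=; lia.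
    by move/gc'/cyc_dist => /andP[].
  rewrite disjoint_subset; apply/subsetP => _ /imsetP[i iR ->].
  rewrite inE /= in_carc -leqNgt; move: iR; rewrite inE => ir.
  case: (ltngtP i r) ir => // [ri _|ri _]; last first.
    by have -> : i = w by apply: ord_inj.
  have : cyc z w i by rewrite /cyc /=; lia.
  by move/gc'/cyc_dist => /andP[_ /ltnW].
move=> [e [f [eH fH [s [l [ln es fs]]]]]].
(* Listing [e] and then [f] by distance from [s] gives 2r points in increasing order, since [e] lies
   inside the arc and [f] outside it; this list is the embedding. *)
pose srt (h : {set 'I_n.+1}) := sort (relpre (dist s) leq) (enum h).
have srtP h : pairwise (relpre (dist s) ltn) (srt h).
  have tr : transitive (relpre (dist s) ltn) by move=> x y z /=; apply: ltn_trans.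
  rewrite -sorted_pairwise //.
  have : sorted (relpre (dist s) leq) (srt h) by apply: sort_sorted => x y /=; exact: leq_total.
  have : uniq (srt h) by rewrite sort_uniq enum_uniq.
  rewrite -(map_inj_uniq (@dist_inj _ s)) -!sorted_map.
  by rewrite ltn_sorted_uniq_leq => -> ->.
have srt_mem h : srt h =i h by move=> x; rewrite mem_sort mem_enum.
have srt_size h : size (srt h) = #|h| by rewrite size_sort cardE.
pose t := srt e ++ srt f.
have tsize : size t = 2 * r by rewrite size_cat !srt_size (Hr e) // (Hr f) // mul2n addnn.
have tP : pairwise (relpre (dist s) ltn) t.
  rewrite pairwise_cat !srtP !andbT; apply/allrelP => x y.
  rewrite !srt_mem /= => xe yf.
  have := subsetP es x xe; have := disjointFr fs yf; rewrite !in_carc; lia.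
have tm : {homo (fun i : 'I_(2 * r) => dist s (nth s t i)) : i j / val i < val j >-> i < j}.
  move/(pairwiseP s): tP => tP i j ij.
  by apply: tP => //; rewrite inE tsize ltn_ord.
exists [ffun i : 'I_(2 * r) => nth s t i]; apply/and3P; split.
- apply/injectiveP => i j; rewrite !ffunE => ij; apply: ord_inj.
  case: (ltngtP i j) => // /tm; rewrite ij ltnn //.
- by apply: (@dist_mono_cyc_pres _ _ _ s) => i j ij; rewrite !ffunE; apply: tm.
- apply/forall_inP => h; rewrite !inE => /orP[] /eqP ->.
    suff -> : [ffun i : 'I_(2 * r) => nth s t i] @: [set i : 'I_(2 * r) | i < r] = e by [].
    apply/setP => x; rewrite -(srt_mem e); apply/imsetP/(nthP s) => [[i]|[i]].
      rewrite inE ffunE nth_cat srt_size (Hr e) // => ir ->; rewrite ir.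
      by exists i => //; rewrite srt_size (Hr e).
    rewrite srt_size (Hr e) // => ir <-.
    have i2 : i < 2 * r by lia.
    exists (Ordinal i2); first by rewrite inE.
    by rewrite ffunE nth_cat srt_size (Hr e) // ir.
suff -> : [ffun i : 'I_(2 * r) => nth s t i] @: [set i : 'I_(2 * r) | r <= i] = f by [].
apply/setP => x; rewrite -(srt_mem f); apply/imsetP/(nthP s) => [[i]|[i]].
  rewrite inE ffunE nth_cat srt_size (Hr e) // ltnNge => ir ->; rewrite ir /=.
  by exists (i - r) => //; rewrite srt_size (Hr f) //; have := ltn_ord i; lia.
rewrite srt_size (Hr f) // => ir <-.
have i2 : r + i < 2 * r by lia.
exists (Ordinal i2); first by rewrite inE /= leq_addr.
by rewrite ffunE nth_cat srt_size (Hr e) //= ltnNge leq_addr /= addKn.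
Qed.

Lemma saturatedP n r (H : {set {set 'I_n.+1}}) : 0 < r ->
  saturated r (M1 r) H <->
  [/\ forall e : {set 'I_n.+1}, e \in H -> #|e| = r,
      forall e f : {set 'I_n.+1}, e \in H -> f \in H -> ~ separated e f &
      forall e : {set 'I_n.+1}, #|e| = r -> e \notin H -> exists2 h, h \in H & separated e h].
Proof.
move=> r0; split.
  case/and3P => /forall_inP Hr' Hf Hs.
  have Hr (e : {set 'I_n.+1}) : e \in H -> #|e| = r by move/Hr'/eqP.
  have Hsep (e f : {set 'I_n.+1}) : e \in H -> f \in H -> ~ separated e f.
    by move=> eH fH ef; case/negP: Hf; apply/containsP => //; exists e, f.
  split=> // e er eH.
  have {}Hr (x : {set 'I_n.+1}) : x \in e |: H -> #|x| = r by rewrite !inE => /orP[/eqP ->|/Hr].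
  move: (forallP Hs e); rewrite er eqxx eH /= => /(containsP r0 Hr)[x [y []]].
  rewrite !inE => /orP[/eqP->|xH] /orP[/eqP->|yH] xy.
  - by case: (@separated_irr _ e) => //; rewrite er.
  - by exists y.
  - by exists x => //; apply: separated_sym.
  - by case: (Hsep _ _ xH yH xy).
move=> [Hr Hsep Hs]; apply/and3P; split.
- by apply/forall_inP => e /Hr ->.
- by apply/negP => /containsP[] // e [f [eH fH]]; apply: Hsep.
apply/forallP => e; apply/implyP => /andP[/eqP er eH]; apply/containsP => //.
  by move=> x; rewrite !inE => /orP[/eqP ->|/Hr].
have [h hH eh] := Hs e er eH; exists e, h; split=> //; by rewrite !inE ?eqxx ?hH ?orbT.
Qed.

Lemma subset_between (T : finType) (A B : {set T}) r : B \subset A -> #|B| <= r <= #|A| ->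
  exists e : {set T}, [/\ B \subset e, e \subset A & #|e| = r].
Proof.
move=> BA /andP[Br rA].
have : 0 < #|[set f : {set T} | f \subset A :\: B & #|f| == r - #|B|]|.
  by rewrite cards_draws bin_gt0 cardsD (setIidPr BA) leq_sub2r.
case/card_gt0P => f; rewrite inE => /andP[]; rewrite subsetD => /andP[fA fB] /eqP fr.
exists (B :|: f); split; rewrite ?subsetUl ?subUset ?BA //.
by rewrite cardsU setIC (disjoint_setI0 fB) cards0 fr subn0 subnKC.
Qed.

(** * Occupied arcs and the gaps of an r-set *)

Definition occ {n} (H : {set {set 'I_n.+1}}) s l : bool := [exists e in H, e \subset carc s l].

Definition nocc {n} (H : {set {set 'I_n.+1}}) l : nat := #|[set s | occ H s l]|.

Lemma cshiftK n (s : 'I_n.+1) l : l <= n.+1 -> cshift (cshift s l) (n.+1 - l) = s.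
Proof.
move=> ln; apply: ord_inj; have := @cshiftP n s l ln.
have := @cshiftP n (cshift s l) (n.+1 - l) (leq_subr _ _); lia.
Qed.

Lemma cshift_inj n l : l <= n.+1 -> injective (fun s : 'I_n.+1 => cshift s l).
Proof. by move=> ln s t /= st; rewrite -(cshiftK s ln) st cshiftK. Qed.

(* [cshift s n] is the point just before [s]. *)
Definition gapset {n} r (s : 'I_n.+1) l :=
  [set e : {set 'I_n.+1} | [&& #|e| == r, cshift s n \in e, cshift s l \in e & [disjoint e & carc s l]]].

(** The two ends are forced, and distinct because l < n. The other r-2 vertices are free in the
    complement of the arc without these ends, which has n-1-l points. *)
Lemma card_gapset n r (s : 'I_n.+1) l : 1 < r -> l < n -> #|gapset r s l| = 'C(n.-1 - l, r - 2).
Proof.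
move=> r2 ln; set x := cshift s n; set y := cshift s l.
have dx : dist s x = n by rewrite dist_cshift.
have dy : dist s y = l by rewrite dist_cshift // ltnW.
have xy : x != y by apply: contraTneq ln => xy; rewrite -dx -dy xy ltnn.
set C := ~: carc s l :\: [set x; y].
have cC : #|C| = n.-1 - l.
  rewrite cardsD (setIidPr _) ?cards2 ?xy.
    by rewrite cardsCs setCK card_ord card_carc; lia.
  by apply/subsetP => z; rewrite !inE => /orP[] /eqP ->; lia.
rewrite -cC -cards_draws; set P := [set f | _ & _].
have -> : #|P| = #|[set [set x; y] :|: f | f in P]|; last first.
  apply: eq_card => e; rewrite inE; apply/idP/imsetP.
    case/and4P => /eqP er xe ye de; exists (e :\: [set x; y]).
      rewrite inE setSD; last by rewrite -disjoints_subset.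
      rewrite cardsD (setIidPr _) ?er ?cards2 ?xy ?eqxx //.
      by apply/subsetP => z; rewrite !inE => /orP[] /eqP ->.
    apply/setP => z; rewrite !inE; case: eqP => [->|]; first by rewrite xe.
    by case: eqP => [->|].
  case=> f; rewrite inE => /andP[fC /eqP fr] ->; rewrite !inE !eqxx orbT /=.
  have /andP[fc fxy] : (f \subset ~: carc s l) && [disjoint f & [set x; y]].
    by rewrite -subsetD.
  rewrite cardsU setIC (disjoint_setI0 fxy) cards0 subn0 cards2 xy fr subnKC // eqxx /=.
  rewrite disjoints_subset subUset fc andbT.
  by apply/subsetP => z; rewrite !inE => /orP[] /eqP ->; lia.
rewrite card_in_imset // => f g; rewrite !inE !subsetD => /andP[/andP[_ fd] _] /andP[/andP[_ gd] _] E.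
apply/setP => z; move/setP/(_ z): E; rewrite !(in_setU z [set x; y]).
have [zxy _|_] := boolP (z \in [set x; y]); last by rewrite !orFb.
by rewrite (disjointFl fd zxy) (disjointFl gd zxy).
Qed.

(* On [m+1] points, the number of [q]-sets with an occupied gap when exactly [l]
   arcs of each length [q <= l <= m+1-q] are occupied. *)
Definition maxgap m q := \sum_(q <= l < m.+2 - q) l * 'C(m.-1 - l, q - 2).

(* Pairing [l] with [n+1-l] turns each complementary pair of gap lengths into a
   single inequality, because the two counts add up to [n+1]. *)
Lemma sum_fold n r (F : nat -> nat) : 2 * (\sum_(r <= l < n.+2 - r) F l) =
  \sum_(r <= l < n.+2 - r) (F l + F (n.+1 - l)).
Proof.
rewrite big_split /= mul2n -addnn; congr (_ + _).
rewrite big_nat_rev /=; apply: eq_big_nat => l hl; congr F; lia.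
Qed.

(** * Counting the edges of a saturated family *)

Section Saturated.
Variables (n r : nat) (H : {set {set 'I_n.+1}}).
Hypothesis r2 : 1 < r.
Hypothesis satH : saturated r (M1 r) H.

Let r0 : 0 < r. Proof. exact: ltnW. Qed.

Lemma sat_card (e : {set 'I_n.+1}) : e \in H -> #|e| = r.
Proof. by case/(saturatedP _ r0): satH => + _ _; apply. Qed.

Lemma sat_nonsep (e f : {set 'I_n.+1}) : e \in H -> f \in H -> ~ separated e f.
Proof. by case/(saturatedP _ r0): satH => _ + _; apply. Qed.

Lemma sat_sep (e : {set 'I_n.+1}) : #|e| = r -> e \notin H ->
  exists2 h, h \in H & separated e h.
Proof. by case/(saturatedP _ r0): satH => _ _; apply. Qed.

Lemma occ_size s l : l <= n.+1 -> occ H s l -> r <= l.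
Proof.
move=> ln /exists_inP[e /sat_card <-] /subset_leq_card; by rewrite card_carc.
Qed.

Lemma occ_meet s l t k : l <= n.+1 -> k <= n.+1 -> occ H s l -> occ H t k ->
  exists2 u, u \in carc s l & u \in carc t k.
Proof.
move=> ln kn /exists_inP[e eH es] /exists_inP[f fH ft].
case: (boolP [disjoint carc s l & carc t k]) => [D|/pred0Pn[u /andP[us ut]]]; last by exists u.
case: (sat_nonsep eH fH); exists s, l; split=> //.
by rewrite disjoint_sym; apply: disjointWr D.
Qed.

Lemma occ_edge (e : {set 'I_n.+1}) s l : l <= n.+1 -> occ H s l -> e \in H -> ~~ [disjoint e & carc s l].
Proof.
move=> ln /exists_inP[h hH hs] eH; apply/negP => es.
by case: (sat_nonsep hH eH); exists s, l; split.
Qed.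

Lemma nonedge_occ (e : {set 'I_n.+1}) : #|e| = r -> e \notin H ->
  exists s l, [/\ l <= n.+1, occ H s l & [disjoint e & carc s l]].
Proof.
move=> er eH; have [h hH /separated_sym [s [l [ln hs es]]]] := sat_sep er eH.
by exists s, l; split=> //; apply/exists_inP; exists h.
Qed.

Hypothesis rn : 2 * r <= n.+1.

(* An edge through both ends of an unoccupied arc could only be blocked by an
   edge inside the arc or inside its complement. *)
Lemma occ_or s l : r <= l <= n.+1 -> occ H s l || occ H (cshift s l) (n.+1 - l).
Proof.
move=> /andP[rl ln].
have l0 : 0 < l <= n.+1 by lia.
have ln' : l.-1 <= n by lia.
have sub : [set s; cshift s l.-1] \subset carc s l.
  apply/subsetP => x; rewrite !inE => /orP[] /eqP ->; rewrite ?distxx ?dist_cshift //; lia.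
have [|e [se el er]] := subset_between (r := r) sub.
  by rewrite card_carc // rl andbT cards2; case: (_ != _).
have [eH|eH] := boolP (e \in H).
  by apply/orP; left; apply/exists_inP; exists e.
have [t [k [kn /exists_inP[h hH ht] et]]] := nonedge_occ er eH.
have st : s \notin carc t k by rewrite (disjointFr et) // (subsetP se) // !inE eqxx.
have st' : cshift s l.-1 \notin carc t k.
  by rewrite (disjointFr et) // (subsetP se) // !inE eqxx orbT.
have [tl|tl] := carc_dichotomy l0 st st'.
- by apply/orP; left; apply/exists_inP; exists h => //; apply: subset_trans tl.
- apply/orP; right; apply/exists_inP; exists h => //; rewrite -carcC //.
  exact: subset_trans tl.
Qed.

Lemma occ_dual s l : l <= n.+1 -> occ H (cshift s l) (n.+1 - l) = ~~ occ H s l.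
Proof.
move=> ln; apply/idP/idP => [o1|].
  apply/negP => o2; have [u us] := occ_meet ln (leq_subr l n.+1) o2 o1.
  by rewrite -carcC // inE us.
have [rl|lr] := leqP r l.
  by have := @occ_or s l; rewrite rl ln => /(_ isT) /orP[] ->.
(* The complement of an arc shorter than r has at least r vertices since 2r <= n+1, so [occ_or]
   applies to it instead. *)
have : r <= n.+1 - l <= n.+1 by lia.
by move=> /(occ_or (cshift s l)); rewrite cshiftK // subKn // orbC => /orP[] ->.
Qed.

Lemma nocc_dual l : l <= n.+1 -> nocc H l + nocc H (n.+1 - l) = n.+1.
Proof.
move=> ln; have := cardsC [set s | occ H s l]; rewrite card_ord => E.
rewrite -[RHS]E; congr (_ + _).
rewrite /nocc -(card_preimset _ (cshift_inj ln)).
by apply: eq_card => s; rewrite !inE occ_dual.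
Qed.

Lemma nocc_small l : l < r -> nocc H l = 0.
Proof.
move=> lr; apply: eq_card0 => s; rewrite inE; apply: contraTF (lr) => o.
have : l <= n.+1 by lia.
by move/occ_size/(_ o); rewrite -leqNgt.
Qed.

(* Katona's cycle argument: among the arcs meeting a fixed one, those starting
   at distance [i] and [i + (n+1-l)] from its start are disjoint. *)
Lemma nocc_le l : 2 * l <= n.+1 -> nocc H l <= l.
Proof.
move=> ln; have ln' : l <= n.+1 by lia.
rewrite /nocc; have [->|[a aS]] := set_0Vmem [set s | occ H s l]; first by rewrite cards0.
have near s t : s \in [set s | occ H s l] -> t \in [set s | occ H s l] ->
    dist s t < l \/ dist t s < l.
  rewrite !inE => so to; have [u] := occ_meet ln' ln' so to.
  by rewrite !in_carc; circ_from u.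
pose g s := if dist a s < l then dist a s else dist a s - (n.+1 - l).
rewrite cardE -(size_map g) -[X in _ <= X](size_iota 0); apply: uniq_leq_size.
  rewrite map_inj_in_uniq ?enum_uniq // => s t; rewrite !mem_enum => sS tS.
  have := near _ _ sS tS; have := near _ _ aS sS; have := near _ _ aS tS.
  rewrite /g => H1 H2 H3 E; apply: (@dist_inj _ a).
  by move: E H1 H2 H3; clear near; case: (ltnP (dist a s) l); case: (ltnP (dist a t) l); circ_from a.
move=> _ /mapP[s + ->]; rewrite mem_enum mem_iota /= add0n => sS.
have := near _ _ aS sS; rewrite /g; clear near; case: (ltnP (dist a s) l) => //; circ_from a.
Qed.

(** Seen from the start [t] of an occupied arc missing [e], let [x] and [y] be the last and first
    vertices of [e]. The gap from just after [x] up to [y] contains that arc, so it is occupied as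
    well. *)
Lemma nonedge_gap (e : {set 'I_n.+1}) : #|e| = r -> e \notin H ->
  exists s l, [/\ l < n, occ H s l & e \in gapset r s l].
Proof.
move=> er eH; have [t [k [kn /exists_inP[h hH ht] et]]] := nonedge_occ er eH.
have /card_gt0P[y0 y0e] : 0 < #|e| by rewrite er.
pose x := [arg max_(u > y0 in e) dist t u]; pose y := [arg min_(u < y0 in e) dist t u].
have [xe xmax] : x \in e /\ forall u, u \in e -> dist t u <= dist t x.
  by rewrite /x; case: arg_maxnP.
have [ye ymin] : y \in e /\ forall u, u \in e -> dist t y <= dist t u.
  by rewrite /y; case: arg_minnP.
have xy : dist t y < dist t x.
  rewrite ltnNge; apply/negP => xy; have : #|e| <= #|[set x]|.
    apply/subset_leq_card/subsetP => u ue; rewrite inE; apply/eqP.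
    by apply: (@dist_inj _ t); have := xmax _ ue; have := ymin _ ue; lia.
  by rewrite cards1 er; lia.
have ky : k <= dist t y by have := disjointFr et ye; rewrite in_carc; lia.
pose s := cshift x 1.
have ds : dist s x = n.
  by rewrite /s; have := @cshiftP n x 1 isT; circ.
have dtx := dist_lt t x.
(* The successor of [x] wraps round to [t] itself when [x] is the vertex just before [t]. *)
have dts : dist t s = if dist t x == n then 0 else (dist t x).+1.
  by case: eqP; circ_from t.
exists s, (dist s y).
have yn : dist s y < n.
  by move: ds dts dtx; case: eqP; circ_from t.
split=> //.
  apply/exists_inP; exists h => //; apply: (subset_trans ht).
  by apply/subsetP => u; rewrite !in_carc; move: ds dts dtx; case: eqP; circ_from t.
have sx : cshift s n = x by rewrite -(cshift_dist s x) ds.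
rewrite inE er eqxx sx cshift_dist xe ye /= disjoint_subset.
apply/subsetP => u ue; rewrite inE in_carc.
by have := xmax _ ue; have := ymin _ ue; move: ds dts dtx; case: eqP; circ_from t.
Qed.

Lemma gap_nonedge (e : {set 'I_n.+1}) s l :
  l < n -> occ H s l -> e \in gapset r s l -> e \notin H.
Proof.
move=> ln so; rewrite inE => /and4P[_ _ _ de]; apply/negP => eH.
have ln' : l <= n.+1 by lia.
by have := occ_edge ln' so eH; rewrite de.
Qed.

(** The two occupied arcs share a vertex [u], and a gap of [e] containing [u] is fixed by the
    nearest vertices of [e] on either side of [u]. *)
Lemma gap_unique (e : {set 'I_n.+1}) s l t k : l < n -> k < n -> occ H s l -> occ H t k ->
  e \in gapset r s l -> e \in gapset r t k -> s = t /\ l = k.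
Proof.
move=> ln kn so to es et.
have ln' : l <= n.+1 by lia.
have kn' : k <= n.+1 by lia.
have [u us ut] := occ_meet ln' kn' so to.
have half a b i j : j < n -> e \in gapset r a i -> e \in gapset r b j -> u \in carc b j ->
    dist u (cshift b j) <= dist u (cshift a i) /\ dist (cshift b n) u <= dist (cshift a n) u.
  move=> jn; rewrite !inE => /and4P[_ xa ya _] /and4P[_ _ _ db].
  have := disjointFr db xa; have := disjointFr db ya; rewrite !in_carc.
  have := @dist_cshift n b j (ltnW jn); have := @dist_cshift n b n (leqnn n).
  move: (cshift a n) (cshift a i) (cshift b n) (cshift b j) => xa' ya' xb yb; clear.
  by split; circ_from b.
have [h1 h2] := half _ _ _ _ kn es et ut; have [h3 h4] := half _ _ _ _ ln et es us.
have st : s = t.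
  apply: (cshift_inj (leqnSn n)); apply: (@dist_injl _ u) => /=.
  by apply/eqP; rewrite eqn_leq h4 h2.
split=> //; rewrite -(dist_cshift s (ltnW ln)) -(dist_cshift s (ltnW kn)); congr dist.
by apply: (@dist_inj _ u); rewrite [in RHS]st; apply/eqP; rewrite eqn_leq h1 h3.
Qed.

(** Double counting: by [nonedge_gap] and [gap_unique] each non-edge lies in [gapset] for exactly
    one occupied arc, and [card_gapset] gives the size of each class. *)
Lemma card_nonedges :
  #|H| + \sum_(l < n) nocc H l * 'C(n.-1 - l, r - 2) = 'C(n.+1, r).
Proof.
pose D := [set e : {set 'I_n.+1} | #|e| == r] :\: H.
have HD : H \subset [set e : {set 'I_n.+1} | #|e| == r].
  by apply/subsetP => e eH; rewrite inE sat_card.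
have -> : 'C(n.+1, r) = #|H| + #|D|.
  by rewrite cardsDS // subnKC ?subset_leq_card // card_draws card_ord.
congr (_ + _).
have -> : #|D| = \sum_(e : {set 'I_n.+1})
    \sum_(p : 'I_n * 'I_n.+1) (occ H p.2 p.1 && (e \in gapset r p.2 p.1)).
  rewrite -sum1_card big_mkcond /=; apply: eq_bigr => e _.
  have [eD|eD] := boolP (e \in D).
    move: eD; rewrite !inE => /andP[eH /eqP er].
    have [s [l [ln so es]]] := nonedge_gap er eH.
    rewrite (bigD1 (Ordinal ln, s)) //= so es big1 // => -[k t] /= kt.
    case: (boolP (_ && _)) => // /andP[to et]; case/eqP: kt.
    have [-> E] := gap_unique (ltn_ord k) ln to so et es.
    by congr pair; apply: ord_inj.
  rewrite big1 // => -[k t] _ /=.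
  case: (boolP (_ && _)) => // /andP[to et]; case/negP: eD.
  rewrite !inE (gap_nonedge _ to et) //=; by move: et; rewrite inE => /and4P[].
rewrite exchange_big /= -(pair_bigA _ (fun (l : 'I_n) (s : 'I_n.+1) =>
  \sum_(e : {set 'I_n.+1}) (occ H s l && (e \in gapset r s l) : nat))) /=.
apply: eq_bigr => l _; rewrite /nocc -sum1_card big_distrl /= [LHS]big_mkcond /=.
apply: eq_bigr => s _; rewrite inE; case: (occ H s l) => /=; last by rewrite big1.
by rewrite mul1n -(card_gapset s r2 (ltn_ord l)) -sum1_card [LHS]big_mkcond.
Qed.

(* [r <= l <= n+1-r]: shorter arcs are never occupied, longer gaps leave no
   room for the rest of an edge. *)
Lemma card_sat :
  #|H| + \sum_(r <= l < n.+2 - r) nocc H l * 'C(n.-1 - l, r - 2) = 'C(n.+1, r).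
Proof.
rewrite -card_nonedges; congr (_ + _).
rewrite -(big_mkord xpredT (fun l => nocc H l * 'C(n.-1 - l, r - 2))).
rewrite (@big_cat_nat _ _ _ r 0 n) //=; last by lia.
rewrite (@big_cat_nat _ _ _ (n.+2 - r) r n) //=; try lia.
rewrite [X in _ = X + _]big1_seq ?[X in _ = _ + (_ + X)]big1_seq ?addn0 //.
  move=> l; rewrite mem_index_iota => /= /andP[h1 h2]; rewrite bin_small ?muln0 //; lia.
by move=> l; rewrite mem_index_iota => /= h; rewrite nocc_small ?mul0n.
Qed.

(** The two counts have a fixed sum. Raising the one for the shorter arcs to its maximum moves
    weight onto the larger of the two binomial coefficients. *)
Lemma fold_term l : r <= l < n.+2 - r ->
  nocc H l * 'C(n.-1 - l, r - 2) + nocc H (n.+1 - l) * 'C(n.-1 - (n.+1 - l), r - 2) <=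
  l * 'C(n.-1 - l, r - 2) + (n.+1 - l) * 'C(n.-1 - (n.+1 - l), r - 2).
Proof.
have wlog_term k : r <= k < n.+2 - r -> 2 * k <= n.+1 ->
  nocc H k * 'C(n.-1 - k, r - 2) + nocc H (n.+1 - k) * 'C(n.-1 - (n.+1 - k), r - 2) <=
  k * 'C(n.-1 - k, r - 2) + (n.+1 - k) * 'C(n.-1 - (n.+1 - k), r - 2).
  move=> hk k2; have kn : k <= n.+1 by lia.
  have := nocc_le k2; have := nocc_dual kn.
  have : 'C(n.-1 - (n.+1 - k), r - 2) <= 'C(n.-1 - k, r - 2) by apply: leq_bin2l; lia.
  move: (nocc H k) (nocc H (n.+1 - k)) ('C(_, _)) ('C(_, _)) => a b c d cd ab ak.
  have -> : b = n.+1 - a by lia.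
  have -> : n.+1 - a = (n.+1 - k) + (k - a) by lia.
  have -> : k = a + (k - a) by lia.
  rewrite !mulnDl; nia.
move=> hl; case: (leqP (2 * l) n.+1) => l2; first exact: wlog_term.
have := wlog_term (n.+1 - l); rewrite subKn; last by lia.
by move=> W; rewrite [X in X <= _]addnC [X in _ <= X]addnC; apply: W; lia.
Qed.

Lemma sum_le_maxgap :
  \sum_(r <= l < n.+2 - r) nocc H l * 'C(n.-1 - l, r - 2) <= maxgap n r.
Proof.
rewrite -(leq_pmul2l (isT : 0 < 2)) /maxgap !sum_fold.
rewrite big_nat [X in _ <= X]big_nat; apply: leq_sum => l hl; exact: fold_term.
Qed.

Lemma sat_lower : 'C(n.+1, r) <= #|H| + maxgap n r.
Proof. by rewrite -card_sat leq_add2l sum_le_maxgap. Qed.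

(** With the later folded terms bounded by [fold_term], equality of the totals leaves no slack in
    the term l = r. Its two coefficients differ, which pins down [nocc H r]. *)
Lemma sat_lower_eq : 'C(n.+1, r) = #|H| + maxgap n r ->
  2 * r < n.+1 -> 2 < r -> nocc H r = r.
Proof.
move=> E rn' r3; have : \sum_(r <= l < n.+2 - r) nocc H l * 'C(n.-1 - l, r - 2) = maxgap n r.
  by apply/eqP; rewrite -(eqn_add2l #|H|) card_sat E.
move/(congr1 (muln 2)); rewrite /maxgap !sum_fold.
rewrite !(@big_ltn _ _ _ r) /=; try lia.
move=> S; apply/eqP; rewrite eqn_leq (nocc_le rn) /=.
have : \sum_(r.+1 <= l < n.+2 - r) (nocc H l * 'C(n.-1 - l, r - 2) + nocc H (n.+1 - l) * 'C(n.-1 - (n.+1 - l), r - 2)) <=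
  \sum_(r.+1 <= l < n.+2 - r) (l * 'C(n.-1 - l, r - 2) + (n.+1 - l) * 'C(n.-1 - (n.+1 - l), r - 2)).
  rewrite big_nat [X in _ <= X]big_nat; apply: leq_sum => l hl; apply: fold_term; lia.
move: S; set X := (X in _ + X = _); set Y := (Y in _ = _ + Y) => S XY.
have rn1 : r <= n.+1 by lia.
have := nocc_dual rn1; have := nocc_le rn.
have {XY S} : r * 'C(n.-1 - r, r - 2) + (n.+1 - r) * 'C(n.-1 - (n.+1 - r), r - 2) <=
  nocc H r * 'C(n.-1 - r, r - 2) + nocc H (n.+1 - r) * 'C(n.-1 - (n.+1 - r), r - 2) by lia.
have -> : n.-1 - (n.+1 - r) = r - 2 by lia.
(* The strict bounds on n and r enter here: arcs of length r carry weight at least C(r-1, r-2) = r-1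
   > 1, their complements weight 1. *)
have : 1 < 'C(n.-1 - r, r - 2).
  have hr : r.-1 <= n.-1 - r by lia.
  apply: leq_trans (leq_bin2l _ hr).
  have -> : r.-1 = (r - 2).+1 by lia.
  by rewrite binSn; lia.
rewrite binn; move: (nocc H r) (nocc H (n.+1 - r)) ('C(_, _)) => a b c; nia.
Qed.

End Saturated.

(** * Saturation of the family [Hn] *)

Lemma carc_sub n (s v : 'I_n.+1) l k : 0 < k <= l -> l <= n.+1 -> v \in carc s l ->
  exists2 t, v \in carc t k & carc t k \subset carc s l.
Proof.
(* The shorter arc starts at [v], or earlier if it would otherwise run past the end of the longer
   one. *)
rewrite in_carc => kl ln vs; pose m := minn (dist s v) (l - k).
have mn : m <= n by rewrite /m; lia.
have := dist_cshift s mn; exists (cshift s m); rewrite ?in_carc.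
  by move: H; rewrite /m; circ_from s.
by apply/subsetP => u; rewrite !in_carc; move: H; rewrite /m; circ_from s.
Qed.

Lemma mem_Hn n r (e : {set 'I_n.+1}) : 0 < r <= n.+1 ->
  reflect (#|e| = r /\ (ord0 \in e \/ exists a b : 'I_n.+1,
             [/\ a \in e, b \in e & 0 < a < r /\ n.+1 - r + a <= b]))
    (e \in Hn n.+1 r).
Proof.
move=> rn; rewrite inE; apply: (iffP andP) => -[].
  move=> /eqP er /orP[/exists_inP[x xe /eqP x0]|/existsP[j]].
    by split=> //; left; rewrite (_ : ord0 = x) //; apply: ord_inj.
  case/and3P => j0 /exists_inP[a ae /eqP aj] /exists_inP[b be /andP[h1 h2]].
  split=> //; right; exists a, b; split=> //; rewrite aj; split=> //.
  by rewrite j0 ltn_ord.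
move=> er h; split; first by rewrite er.
case: h => [e0|[a [b [ae be [/andP[a0 ar] ab]]]]]; apply/orP; [left|right].
  by apply/exists_inP; exists ord0.
apply/existsP; exists (Ordinal ar); rewrite /= a0 /=; apply/andP; split.
  by apply/exists_inP; exists a.
by apply/exists_inP; exists b => //; rewrite ab /=; have := ltn_ord b; lia.
Qed.

(** Such an arc lies strictly between [b] and [a], where only n - b + a <= r-1 vertices fit. *)
Lemma Hn_gap0 n r (e : {set 'I_n.+1}) t k : 0 < r <= n.+1 -> k <= n.+1 -> e \in Hn n.+1 r ->
  ord0 \in carc t k -> [disjoint e & carc t k] -> k < r.
Proof.
move=> rn kn /(mem_Hn _ rn)[_ [e0|[a [b [ae be [ar ab]]]]]] t0 et.
  by rewrite (disjointFr et e0) in t0.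
have := disjointFr et ae; have := disjointFr et be; move: t0; rewrite !in_carc.
have z0 : val (@ord0 n) = 0 by [].
move: ar ab kn z0; move: (@ord0 n) => z; clear; rewrite /=.
circ.
Qed.

Lemma carc_Hn n r (t : 'I_n.+1) : 0 < r <= n.+1 -> ord0 \in carc t r -> carc t r \in Hn n.+1 r.
Proof.
move=> rn t0; apply/mem_Hn => //; split; last by left.
by rewrite card_carc //; case/andP: rn.
Qed.

(** Of a separating arc and its complement, the one through v_0 would contain an edge, hence r
    vertices, against [Hn_gap0]. The gap around v_0 of a non-edge has length at least r, so it
    contains r consecutive vertices including v_0, and these form an edge. *)
Lemma Hn_saturated n r : 1 < r -> 2 * r <= n.+1 -> saturated r (M1 r) (Hn n.+1 r).
Proof.
move=> r2 rn; have r0 : 0 < r by lia.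
have rn' : 0 < r <= n.+1 by lia.
have nonsep (e f : {set 'I_n.+1}) t k : k <= n.+1 -> e \in Hn n.+1 r -> f \in Hn n.+1 r ->
    e \subset carc t k -> [disjoint f & carc t k] -> ord0 \notin carc t k.
  move=> kn /(mem_Hn _ rn')[er _] fH /subset_leq_card et ft; apply/negP => t0.
  by have := Hn_gap0 rn' kn fH t0 ft; move: et; rewrite card_carc // er; lia.
apply/saturatedP => //; split.
- by move=> e /(mem_Hn _ rn')[].
- move=> e f eH fH [t [k [kn et ft]]]; have := nonsep e f t k kn eH fH et ft; apply/negP.
  have kn' : n.+1 - k <= n.+1 by lia.
  apply/negPn; rewrite -[_ \in _]negbK -in_setC carcC //; apply: (nonsep f e) => //.
    by rewrite -carcC // -disjoints_subset.
  by rewrite -carcC // -setI_eq0 -setDE setD_eq0.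
move=> e er eH.
have e0 : ord0 \notin e by apply: contraNN eH => e0; apply/mem_Hn => //; split=> //; left.
have /card_gt0P[y0 y0e] : 0 < #|e| by rewrite er.
pose x := [arg max_(u > y0 in e) val u]; pose y := [arg min_(u < y0 in e) val u].
have [xe xmax] : x \in e /\ forall u : 'I_n.+1, u \in e -> u <= x.
  by rewrite /x; case: arg_maxnP.
have [ye ymin] : y \in e /\ forall u : 'I_n.+1, u \in e -> y <= u.
  by rewrite /y; case: arg_minnP.
clearbody x y.
have ypos : 0 < y.
  by rewrite lt0n; apply: contraNneq e0 => y0'; rewrite (_ : ord0 = y) //; apply: ord_inj.
pose s := cshift x 1; have Hs := @cshiftP n x 1 isT; rewrite -/s in Hs; clearbody s.
pose l := dist s y.
have yx : y <= x by apply: ymin.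
have xn := ltn_ord x.
have lE : l = y + n - x.
  by rewrite /l; move: Hs yx ypos; clear; circ.
clearbody l.
have ln : l <= n.+1 by lia.
(* A shorter gap would make [y] and [x] one of the pairs in the definition of [Hn]. *)
have rl : r <= l.
  rewrite leqNgt; apply: contraNN eH => lr; apply/mem_Hn => //; split=> //; right.
  by exists y, x; split=> //; lia.
have s0 : ord0 \in carc s l.
  have z0 : val (@ord0 n) = 0 by [].
  rewrite in_carc lE; move: Hs yx ypos z0.
  by move: (@ord0 n) => z; clear; rewrite /=; circ.
have rl' : 0 < r <= l by lia.
have [t t0 ts] := carc_sub rl' ln s0.
exists (carc t r); first exact: carc_Hn.
apply: separated_sym; exists s, l; split=> //.
rewrite disjoint_subset; apply/subsetP => u ue; rewrite inE /= in_carc -leqNgt lE.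
by have := xmax _ ue; have := ymin _ ue; move: Hs yx ypos; clear; circ.
Qed.

(** * Families centred at a vertex, and uniqueness *)

Definition centred {n} r (H : {set {set 'I_n.+1}}) v := forall s, v \in carc s r -> occ H s r.

Lemma Hn_centred n r : 0 < r <= n.+1 -> centred r (Hn n.+1 r) ord0.
Proof. by move=> rn s s0; apply/exists_inP; exists (carc s r) => //; apply: carc_Hn. Qed.

(** An arc through [v] contains an arc of length r through [v]; an arc avoiding [v] has an occupied
    complement, so duality excludes it. *)
Lemma occ_centred n r (H : {set {set 'I_n.+1}}) v s l : 1 < r -> 2 * r <= n.+1 ->
  saturated r (M1 r) H -> centred r H v -> r <= l <= n.+1 - r -> occ H s l = (v \in carc s l).
Proof.
move=> r2 rn satH Hv rl.
have up t k : r <= k <= n.+1 -> v \in carc t k -> occ H t k.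
  move=> /andP[rk kn]; have rk' : 0 < r <= k by lia.
  case/(carc_sub rk' kn) => t' /Hv /exists_inP[e eH et'] t't.
  by apply/exists_inP; exists e => //; apply: subset_trans t't.
apply/idP/idP => [so|]; last by apply: up; lia.
have ln : l <= n.+1 by lia.
move: so; apply: contraTT => vs; rewrite -(occ_dual r2 satH rn) //; apply: up; first by lia.
by rewrite -carcC // inE.
Qed.

Lemma card_centred n r (H : {set {set 'I_n.+1}}) v : 1 < r -> 2 * r <= n.+1 ->
  saturated r (M1 r) H -> centred r H v -> #|H| + maxgap n r = 'C(n.+1, r).
Proof.
move=> r2 rn satH Hv; rewrite -(card_sat r2 satH rn); congr (_ + _).
apply: eq_big_nat => l rl; congr (_ * _).
rewrite -[LHS](@card_carc_starts n v); last by lia.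
apply: eq_card => s; rewrite !inE (occ_centred s r2 rn satH Hv) ?inE //; lia.
Qed.

(** The criterion mentions only [v], so the centre determines the whole family; [centred_iso] then
    needs only the rotation taking one centre to the other. *)
Lemma mem_centred n r (H : {set {set 'I_n.+1}}) v e : 1 < r -> 2 * r <= n.+1 ->
  saturated r (M1 r) H -> centred r H v ->
  e \in H <-> #|e| = r /\ forall s l, r <= l <= n.+1 - r -> v \in carc s l ->
                ~~ [disjoint e & carc s l].
Proof.
move=> r2 rn satH Hv; split=> [eH|[er He]].
  split=> [|s l rl vs]; first exact: (sat_card r2 satH).
  apply: (occ_edge r2 satH) => //; first by lia.
  by rewrite (occ_centred s r2 rn satH Hv).
apply/negPn/negP => eH.
have [s [l [ln so es]]] := nonedge_occ r2 satH er eH.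
have rl := occ_size r2 satH ln so.
have lr : r <= n.+1 - l.
  rewrite -er -(card_carc (cshift s l) (leq_subr l n.+1)) -carcC //.
  by rewrite subset_leq_card // -disjoints_subset.
have rl2 : r <= l <= n.+1 - r by lia.
by have := He s l rl2; rewrite es -(occ_centred s r2 rn satH Hv) // so => /(_ isT).
Qed.

Lemma dist_cshift2 n (a b : 'I_n.+1) k : k <= n.+1 -> dist (cshift a k) (cshift b k) = dist a b.
Proof. by move=> kn; have := @cshiftP n a k kn; have := @cshiftP n b k kn; circ. Qed.

Lemma centred_iso n r (H1 H2 : {set {set 'I_n.+1}}) v1 v2 : 1 < r -> 2 * r <= n.+1 ->
  saturated r (M1 r) H1 -> saturated r (M1 r) H2 ->
  centred r H1 v1 -> centred r H2 v2 -> cgh_iso H1 H2.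
Proof.
move=> r2 rn sat1 sat2 Hv1 Hv2.
pose k := dist v1 v2; pose f (x : 'I_n.+1) := cshift x k.
have kn : k <= n.+1 by apply: ltnW; apply: dist_lt.
have finj : injective f := cshift_inj kn.
have fv : f v1 = v2 by apply: cshift_dist.
have fP x : exists y, f y = x.
  by exists (cshift x (n.+1 - k)); have := cshiftK x (leq_subr k n.+1); rewrite subKn.
have fcarc s l : f @: carc s l = carc (f s) l.
  apply/setP => x; have [y <-] := fP x; rewrite mem_imset // !in_carc.
  by rewrite dist_cshift2.
exists f; split.
- by apply: injF_bij.
- apply/forallP => a; apply/forallP => b; apply/forallP => c; apply/implyP; rewrite /cyc.
  have := @cshiftP n a k kn; have := @cshiftP n b k kn; have := @cshiftP n c k kn.
  rewrite /f; lia.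
move=> e; apply/idP/idP.
  move=> /(mem_centred _ r2 rn sat1 Hv1)[er He].
  apply/(mem_centred _ r2 rn sat2 Hv2); rewrite card_imset //; split=> // t l rl.
  have [s <-] := fP t; rewrite -fv -fcarc mem_imset // => vs.
  by rewrite imset_disjoint ?He.
move=> /(mem_centred _ r2 rn sat2 Hv2)[er He].
apply/(mem_centred _ r2 rn sat1 Hv1); move: er; rewrite card_imset //; split=> // s l rl vs.
rewrite -(imset_disjoint finj) fcarc.
by apply: He => //; rewrite -fv -fcarc mem_imset.
Qed.

(** On at least 7 points three pairwise meeting arcs of length 3 have consecutive starts. On 6
    points this fails, as the starts 0, 2, 4 show. *)
Lemma nocc3_centred n (H : {set {set 'I_n.+1}}) : 6 <= n -> saturated 3 (M1 3) H ->
  nocc H 3 = 3 -> exists v, centred 3 H v.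
Proof.
move=> n6 satH; rewrite /nocc cardE; set S := [set s | occ H s 3].
have mS s : (s \in enum S) = occ H s 3 by rewrite mem_enum inE.
have near s t : occ H s 3 -> occ H t 3 -> dist s t < 3 \/ dist t s < 3.
  move=> so to; have n3 : 3 <= n.+1 by lia.
  have [u] := occ_meet (r := 3) isT satH n3 n3 so to.
  by rewrite !in_carc; circ_from u.
have := enum_uniq S; move: (enum S) mS => [|a [|b [|c []]]] //= mS U _.
have {U}[ab ac bc] : [/\ a != b, a != c & b != c].
  by move: U; rewrite !inE negb_or => /and3P[/andP[-> ->] -> _].
have oa : occ H a 3 by rewrite -mS !inE eqxx.
have ob : occ H b 3 by rewrite -mS !inE eqxx orbT.
have oc : occ H c 3 by rewrite -mS !inE eqxx !orbT.
have dab : dist a b != 0 by apply: contraNneq ab => d0; apply/eqP/(@dist_inj _ a); rewrite d0 distxx.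
have dac : dist a c != 0 by apply: contraNneq ac => d0; apply/eqP/(@dist_inj _ a); rewrite d0 distxx.
have dbc : dist a b != dist a c by apply: contraNneq bc => d0; apply/eqP/(@dist_inj _ a).
have nab := near a b oa ob; have nac := near a c oa oc; have nbc := near b c ob oc.
have mid v : (forall s, dist s v < 3 -> [|| dist a s == 0, dist a s == dist a b | dist a s == dist a c]) ->
    centred 3 H v.
  move=> Hv s; rewrite in_carc => /Hv /or3P[] /eqP E.
  - by rewrite (_ : s = a) //; apply: (@dist_inj _ a); rewrite E distxx.
  - by rewrite (_ : s = b) //; apply: (@dist_inj _ a).
  - by rewrite (_ : s = c) //; apply: (@dist_inj _ a).
have : [\/ forall s, dist s a < 3 -> [|| dist a s == 0, dist a s == dist a b | dist a s == dist a c],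
   forall s, dist s b < 3 -> [|| dist a s == 0, dist a s == dist a b | dist a s == dist a c] |
   forall s, dist s c < 3 -> [|| dist a s == 0, dist a s == dist a b | dist a s == dist a c]].
  move: dab dac dbc nab nac nbc n6; clear => dab dac dbc nab nac nbc n6.
  (* The centre is whichever of the three starts comes last, the other two preceding it by at most
     2. *)
  have [h|[h|h]] : (dist b a < 3 /\ dist c a < 3) \/ (dist a b < 3 /\ dist c b < 3) \/
     (dist a c < 3 /\ dist b c < 3) by circ_from a.
  - by constructor 1 => s; circ_from a.
  - by constructor 2 => s; circ_from a.
  - by constructor 3 => s; circ_from a.
by case=> /mid; [exists a | exists b | exists c].
Qed.

(** * Evaluation of the binomial sums *)

Lemma sum_bin_rev m k : \sum_(l < m.+1) 'C(m - l, k) = 'C(m.+1, k.+1).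
Proof.
elim: m => [|m IH]; first by rewrite big_ord1 subn0 binS; case: k.
by rewrite big_ord_recl subn0 (eq_bigr _ (fun i _ => erefl)) IH binS addnC.
Qed.

(** This sorts the (k+2)-subsets of 0, ..., m by their second smallest element l: one element is
    chosen below it and k above. *)
Lemma sum_mul_bin_rev m k : \sum_(l < m.+1) l * 'C(m - l, k) = 'C(m.+1, k.+2).
Proof.
elim: m => [|m IH]; first by rewrite big_ord1 mul0n bin_small.
rewrite big_ord_recl mul0n add0n.
under eq_bigr => i _ do rewrite lift0 subSS mulSn.
by rewrite big_split /= sum_bin_rev IH binS addnC.
Qed.

Definition shortgap m q := \sum_(l < q) l * 'C(m.-1 - l, q - 2).

(** Together the two sums run over all l < m, up to terms with l >= m+2-q, whose binomial
    coefficients vanish. *)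
Lemma maxgap_shortgap m q : 1 < q -> 2 * q <= m.+1 -> maxgap m q + shortgap m q = 'C(m, q).
Proof.
move=> q2 qm; have -> : 'C(m, q) = 'C(m.-1.+1, (q - 2).+2) by congr 'C(_, _); lia.
rewrite -sum_mul_bin_rev prednK; last by lia.
rewrite /shortgap /maxgap -!(big_mkord xpredT (fun l => l * 'C(m.-1 - l, q - 2))).
rewrite [RHS](@big_cat_nat _ _ _ q 0 m) //=; last by lia.
rewrite [X in _ = _ + X](@big_cat_nat _ _ _ (m.+2 - q) q m) //=; try lia.
rewrite [X in _ = _ + (_ + X)]big1_seq ?addn0 1?addnC //.
by move=> l; rewrite mem_index_iota => /= /andP[h1 h2]; rewrite bin_small ?muln0 //; lia.
Qed.

Lemma bin_maxgap m q : 1 < q -> 2 * q <= m.+1 ->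
  'C(m.+1, q) = 'C(m, q.-1) + shortgap m q + maxgap m q.
Proof.
move=> q2 qm; rewrite -addnA [shortgap _ _ + _]addnC maxgap_shortgap //.
by case: q q2 {qm} => // q _; rewrite binS addnC.
Qed.

(** * The saturation number and its asymptotics *)

Lemma bigmin_nat_le (T : finType) (P : pred T) (F : T -> nat) d x :
  P x -> \big[minn/d]_(i | P i) F i <= F x.
Proof.
move=> Px; have : x \in index_enum T by rewrite mem_index_enum.
elim: (index_enum T) => // y s IH; rewrite inE big_cons => /orP[/eqP <-|/IH le].
  by rewrite Px geq_minl.
by case: ifP => // _; rewrite geq_min le orbT.
Qed.

Lemma le_bigmin_nat (T : finType) (P : pred T) (F : T -> nat) d m :
  m <= d -> (forall x, P x -> m <= F x) -> m <= \big[minn/d]_(i | P i) F i.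
Proof. by move=> md mF; elim/big_ind: _ => // x y mx my; rewrite leq_min mx. Qed.

Lemma sat_M1 n r : 1 < r -> 2 * r <= n.+1 ->
  sat n.+1 r (M1 r) = 'C(n, r.-1) + shortgap n r.
Proof.
move=> r2 rn; apply/eqP; rewrite eqn_leq; apply/andP; split.
  apply: leq_trans (bigmin_nat_le _ _ (Hn_saturated r2 rn)) _.
  rewrite -(leq_add2r (maxgap n r)) -bin_maxgap //.
  rewrite (card_centred r2 rn (Hn_saturated r2 rn) (@Hn_centred n r _)) //; lia.
(* The default value in [sat], the number of all r-subsets, must respect the bound too. *)
apply: le_bigmin_nat => [|H satH].
  by rewrite card_draws card_ord bin_maxgap // leq_addr.
by rewrite -(leq_add2r (maxgap n r)) -bin_maxgap // sat_lower.
Qed.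

(** The short terms are (n-2) + 2(n-3) = 3(n+1) - 11. *)
Lemma shortgap3 n : 5 <= n -> 'C(n, 2) + shortgap n 3 = 'C(n, 2) + 3 * n.+1 - 11.
Proof. by move=> n5; rewrite /shortgap !big_ord_recr big_ord0 /= !bin1; lia. Qed.

(** All coefficients are 1, so by duality the n-2 folded terms are n+1 each, and twice the number of
    non-edges is (n-2)(n+1). *)
Lemma card_saturated2 n (H : {set {set 'I_n.+1}}) : 4 <= n.+1 ->
  saturated 2 (M1 2) H -> #|H| = n.+1.
Proof.
move=> n4 satH; have E := card_sat (r := 2) isT satH n4.
have S : 2 * \sum_(2 <= l < n.+2 - 2) nocc H l * 'C(n.-1 - l, 2 - 2) = (n.+2 - 2 - 2) * n.+1.
  rewrite sum_fold -sum_nat_const_nat; apply: eq_big_nat => l hl.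
  by rewrite !bin0 !muln1 (nocc_dual (r := 2) isT satH n4) //; lia.
have B := mul_bin_diag n.+1 1; rewrite /= bin1 in B.
move: E S B; move: (\sum_(_ <= _ < _) _) ('C(_, _)) => s c E S B.
have : (n.+2 - 2 - 2) * n.+1 + 2 * n.+1 = n.+1 * n by rewrite -mulnDl mulnC; congr (_ * _); lia.
lia.
Qed.

Lemma shortgap_le n r : 1 < r -> shortgap n r <= r ^ 2 * 'C(n, r - 2).
Proof.
move=> r2; rewrite /shortgap -mulnn -mulnA -[X in _ <= X * _]card_ord -sum_nat_const.
apply: leq_sum => l _; apply: leq_mul; first exact: ltnW.
by apply: leq_bin2l; lia.
Qed.

(** The exact value features C(n, r-1); passing to C(n+1, r-1) costs C(n, r-2) by Pascal's rule,
    which the error term absorbs. *)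
Lemma sat_M1_near n r : 1 < r -> 2 * r <= n.+1 ->
  sat n.+1 r (M1 r) <= 'C(n.+1, r.-1) + r ^ 2 * 'C(n, r - 2) /\
  'C(n.+1, r.-1) <= sat n.+1 r (M1 r) + r ^ 2 * 'C(n, r - 2).
Proof.
move=> r2 rn; rewrite sat_M1 //; have := shortgap_le n r2.
have -> : r.-1 = (r - 2).+1 by lia.
rewrite binS; have : 0 < r ^ 2 by rewrite expn_gt0; lia.
move: ('C(_, _)) ('C(_, _)) (r ^ 2) (shortgap _ _) => a b c d; nia.
Qed.

(** Since (n+1) C(n, r-2) = (r-1) C(n+1, r-1), the relative error is at most r^2 (r-1) / (n+1). *)
Lemma sat_M1_ratio n r : 1 < r -> 2 * r <= n.+1 ->
  (`| (sat n.+1 r (M1 r))%:R / ('C(n.+1, r.-1))%:R - 1 | <= (r ^ 3)%:R / (n.+1)%:R :> rat)%R.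
Proof.
move=> r2 rn; have [up lo] := sat_M1_near r2 rn.
have Cpos : 0 < 'C(n.+1, r.-1) by rewrite bin_gt0; lia.
have D : n.+1 * 'C(n, r - 2) = r.-1 * 'C(n.+1, r.-1).
  by have -> : r.-1 = (r - 2).+1; [lia | rewrite mul_bin_diag].
move: up lo D Cpos; move: (sat _ _ _) ('C(n.+1, _)) ('C(n, _)) => s b c up lo D b0.
have bR : (0 < b%:R :> rat)%R by rewrite ltr0n.
have -> : (s%:R / b%:R - 1 = (s%:R - b%:R) / b%:R :> rat)%R.
  by rewrite mulrBl divff // gt_eqF.
rewrite normrM normfV (ger0_norm (ltW bR)) ler_pdivrMr // mulrAC ler_pdivlMr ?ltr0n //.
have sb : (`|s%:R - b%:R| <= (r ^ 2 * c)%:R :> rat)%R.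
  by rewrite ler_distl -!natrD ler_nat lerBlDr -natrD ler_nat up lo.
apply: le_trans (ler_wpM2r (ler0n _ _) sb) _; rewrite -!natrM ler_nat.
have -> : r ^ 2 * c * n.+1 = r ^ 2 * (r.-1 * b) by rewrite -D; lia.
by rewrite (expnSr r 2) -mulnA leq_mul2l leq_mul2r leq_pred !orbT.
Qed.

Theorem theorem1p1 :
  (forall r : nat, (2 <= r)%N ->
     forall eps : rat, (0 < eps)%R -> exists N : nat, forall n : nat, (N <= n)%N ->
       (`| (sat n r (M1 r))%:R / ('C(n, r.-1))%:R - 1 | < eps)%R)
  /\ (forall n : nat, (4 <= n)%N -> forall H : {set {set 'I_n}},
        saturated 2 (M1 2) H -> #|H| = n)
  /\ (forall n : nat, (6 <= n)%N ->
        sat n 3 (M1 3) = ('C(n.-1, 2) + 3 * n - 11)%N)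
  /\ (forall n : nat, (6 < n)%N ->
        saturated 3 (M1 3) (Hn n 3) /\ #|Hn n 3| = ('C(n.-1, 2) + 3 * n - 11)%N /\
        forall H : {set {set 'I_n}}, saturated 3 (M1 3) H ->
          #|H| = ('C(n.-1, 2) + 3 * n - 11)%N -> cgh_iso H (Hn n 3)).
Proof.
split=> [r r2 eps eps0|].
  (* With this [q], r^3 / eps < q+1, so any number of points from q+1 on brings the error below eps;
     2r is the threshold for the exact formula. *)
  pose q := Num.truncn ((r ^ 3)%:R / eps)%R.
  exists (maxn (2 * r) q.+1) => -[|n]; first by rewrite leqn0; lia.
  rewrite geq_max => /andP[rn qn]; apply: le_lt_trans (sat_M1_ratio r2 rn) _.
  rewrite ltr_pdivrMr ?ltr0n // mulrC -ltr_pdivrMr //.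
  apply: lt_le_trans (truncnS_gt _) _; by rewrite ler_nat.
split=> [[|n] // n4 H|]; first exact: card_saturated2.
split=> [[|n] // n6|[|n] // n7]; first by rewrite sat_M1 // shortgap3.
have n6 : 2 * 3 <= n.+1 by lia.
have satHn := Hn_saturated (r := 3) isT n6.
have n3 : 0 < 3 <= n.+1 by lia.
have cHn := @Hn_centred n 3 n3.
have small (H : {set {set 'I_n.+1}}) : #|H| + maxgap n 3 = 'C(n.+1, 3) <->
    #|H| = 'C(n, 2) + 3 * n.+1 - 11.
  by rewrite -shortgap3 // bin_maxgap //=; split=> [/addIn|->].
split=> //; split; first by apply/small/(card_centred (r := 3) isT n6 satHn cHn).
move=> H satH /small E.
have [v cH] := nocc3_centred n7 satH (sat_lower_eq (r := 3) isT satH n6 (esym E) n7 isT).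
exact: (centred_iso (r := 3) isT n6 satH satHn cH cHn).
Qed.
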